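(* Suppose $\mu_i=\mu$ for all $i\in[N]$ and the graph $\mathcal G_t$ is $\mathcal D$-regular. Then the number of iterations $$K_t=\frac{\log\left(\dfrac{T^4\cdot 128\,\beta l N\,(M_f+M_s^2/2)\,(\mu+\lambda_1)}{(\sigma_t\lambda_1)^2}\right)}{\log\left(\dfrac{4\beta l}{4\beta l-\sigma_t}\right)},\qquad \lambda_1=\frac{2}{1+\sqrt{1+4/\mu}},$$ scales tightly as $$K_t=\Theta\big(\mathcal D\log(N\mathcal D^2T^4)\big)\qquad\text{for all }\mathcal D\ge2,$$ where the constants hidden in $\Theta(\cdot)$ are independent of $\mathcal D$, $N$ and $T$.
   Context: $N$ is the number of agents, $T$ the horizon, $\beta>0$, $0<m\le l$, $\mu>0$ are fixed, and $M_f,M_s>0$ are fixed constants (a bound on the agents' hitting costs and on the diameter of the action space). $\mathcal G_t=([N],\mathcal E_t)$ is an undirected graph; it is $\mathcal D$-regular if each node has exactly $\mathcal D$ neighbours (connectivity is not assumed). The quantity $$K_t=\frac{\log\left(\dfrac{T^4\cdot 128\,\beta l N\,(M_f+M_s^2/2)\,(\mu+\lambda_1)}{(\sigma_t\lambda_1)^2}\right)}{\log\left(\dfrac{4\beta l}{4\beta l-\sigma_t}\right)},\qquad \lambda_1=\frac{2}{1+\sqrt{1+4/\mu}},$$ is the number of inner iterations per round that the algorithm ACORD uses for its performance guarantee. The quantity $\sigma_t$ is the strong convexity parameter of $$\mathbb F_t(\mathbf x,\mathbf z)=\sum_{i=1}^N\Big\{f_t^i(x^i)+\tfrac{\lambda_1}{2}\|x^i-x_{t-1}^i\|_2^2+\beta\sum_{\mathcal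 E_t\ni e\ni i}\|A_t^e x^i-A_t^e z_e\|_2^2\Big\},\quad \mathbf x=(x^i)_{i\in[N]}\in\mathbb{R}^{Nd},\ \mathbf z=(z_e)_{e\in\mathcal E_t}\in\mathbb{R}^{|\mathcal E_t|d},$$ where the $f_t^i$ are $\mu$-strongly convex and the matrices $A_t^e$ are full-rank with singular values in $[\sqrt m,\sqrt l]$. Explicitly, it is the largest $\sigma$ such that for all $(\mathbf x,\mathbf z)$ $$(\mu+\lambda_1)\sum_i\|x^i\|_2^2+2\beta m\sum_i\sum_{\mathcal E_t\ni e\ni i}\|x^i-z_e\|_2^2\;\ge\;\sigma\Big(\sum_i\|x^i\|_2^2+\sum_{e}\|z_e\|_2^2\Big).$$ *)

(* Defs.v *)
From mathcomp Require Import all_boot all_order all_algebra.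
From mathcomp Require Import reals exp.

Set Implicit Arguments.
Unset Strict Implicit.
Unset Printing Implicit Defensive.

Import Order.TTheory GRing.Theory Num.Theory.
Local Open Scope ring_scope.

Section Graph.
Variable N : nat.

(* An undirected graph ([N], E) is given by its set of edges, an edge being an
   unordered pair of distinct nodes. *)
Definition simple_graph (E : {set {set 'I_N}}) : Prop :=
  forall e, e \in E -> #|e| = 2%N.

Definition neighbours (E : {set {set 'I_N}}) (i : 'I_N) : {set 'I_N} :=
  [set j | [set i; j] \in E].

Definition regular (D : nat) (E : {set {set 'I_N}}) : Prop :=
  forall i, #|neighbours E i| = D.

End Graph.

Section Convexity.
Variable R : realType.

(* Squared Euclidean norm; the library's norm on 'rV[R]_d is the sup norm. *)
Definition sqnorm2 (d : nat) (v : 'rV[R]_d) : R := \sum_(j < d) v 0 j ^+ 2.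

Definition lambda1 (mu : R) : R := 2 / (1 + Num.sqrt (1 + 4 / mu)).

(* z is indexed by all subsets of [N], but only its values on the edges occur. *)
Definition convexity_ineq (N d : nat) (E : {set {set 'I_N}})
    (beta m mu sigma : R) : Prop :=
  forall (x : 'I_N -> 'rV[R]_d) (z : {set 'I_N} -> 'rV[R]_d),
    sigma * (\sum_(i < N) sqnorm2 (x i) + \sum_(e in E) sqnorm2 (z e))
    <= (mu + lambda1 mu) * (\sum_(i < N) sqnorm2 (x i))
       + 2 * beta * m *
         (\sum_(i < N) \sum_(e in E | i \in e) sqnorm2 (x i - z e)).

Definition strong_convexity_param (N d : nat) (E : {set {set 'I_N}})
    (beta m mu sigma : R) : Prop :=
  convexity_ineq d E beta m mu sigma /\
  forall sigma', convexity_ineq d E beta m mu sigma' -> sigma' <= sigma.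

Definition K_iter (beta l mu Mf Ms : R) (N T : nat) (sigma : R) : R :=
  ln (T%:R ^+ 4 * 128 * beta * l * N%:R * (Mf + Ms ^+ 2 / 2)
        * (mu + lambda1 mu) / (sigma * lambda1 mu) ^+ 2)
  / ln (4 * beta * l / (4 * beta * l - sigma)).

End Convexity.

(* Main.v *)
Require Import Defs.
From mathcomp Require Import all_boot all_order all_algebra.
From mathcomp Require Import reals exp.
From mathcomp Require Import sequences ring lra.
Import Order.TTheory GRing.Theory Num.Theory.
Local Open Scope ring_scope.

(** The whole asymptotics rests on the strong convexity parameter of a
    D-regular graph being of exact order 1/D. Write a = mu + lambda1 and
    b = 2 beta m.

    Upper bounds on sigma come from vectors that are constant on nodes and
    constant on edges (convexity_ineq_const). Equal constants cost nothing in
    the coupling term, while D/2 edges per node weigh on the other side, so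
    sigma <= 2a/D (strong_convexity_le_degree). A second choice shows
    sigma <= 2b * (a/(a+2b)) (strong_convexity_le_gap), which keeps sigma
    away from 4 beta l >= 2b uniformly in D. This is what prevents the
    denominator of K_t from blowing up for small degrees.

    The lower bound comes from controlling each edge vector by its two end
    points, |z_e|^2 <= 2|x_i|^2 + 2|x_i - z_e|^2. Summed over incident pairs
    this gives sigma >= min(a,b)/(D+1) (convexity_ineq_inv_degree).

    Since ln y <= y - 1, the denominator ln (A/(A - sigma)), A = 4 beta l, lies
    between sigma/A and sigma/(A - sigma), hence is of order 1/D too. The
    argument of the logarithm in the numerator is N D^2 T^4 times
    a constant divided by (sigma D)^2, which stays between two positive
    constants; so the numerator is ln (N D^2 T^4) up to a bounded additive
    error (log_ratio_Theta). *)

(** * Incidences in a regular graph *)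

Lemma card_incident (N D : nat) (E : {set {set 'I_N}}) (i : 'I_N) :
  simple_graph E -> regular D E -> #|[set e in E | i \in e]| = D.
Proof.
move=> sE rE; rewrite -(rE i).
have loopless j : j \in neighbours E i -> j != i.
  rewrite inE => /sE; rewrite cards2 eq_sym; by case: eqP.
have -> : [set e in E | i \in e] = [set [set i; j] | j in neighbours E i].
  apply/setP => e; rewrite inE; apply/andP/imsetP.
    case=> eE ie; move/eqP: (sE e eE) => /cards2P [u [v [_ def_e]]].
    move: ie eE; rewrite def_e !inE => /orP[/eqP <-|/eqP <-] eE.
      by exists v; rewrite ?inE.
    by exists u; rewrite ?inE setUC.
  by case=> j; rewrite inE => jE ->; rewrite jE !inE eqxx.
apply: card_in_imset => j k /loopless ji _ /setP/(_ j).
by rewrite !inE eqxx orbT (negbTE ji) => /esym/eqP.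
Qed.

Lemma sum_incident_const (R : realType) (N D : nat) (E : {set {set 'I_N}})
    (i : 'I_N) (c : R) :
  simple_graph E -> regular D E -> \sum_(e in E | i \in e) c = D%:R * c.
Proof.
move=> sE rE; rewrite -[in RHS](card_incident _ _ _ i sE rE) mulr_natl.
by rewrite -sumr_const; apply: eq_bigl => e; rewrite inE.
Qed.

Lemma sum_incident_edge (R : realType) (N : nat) (E : {set {set 'I_N}})
    (F : {set 'I_N} -> R) :
  simple_graph E ->
  \sum_(i < N) \sum_(e in E | i \in e) F e = 2 * \sum_(e in E) F e.
Proof.
move=> sE; rewrite (exchange_big_dep (mem E)) /=; last by move=> i e _ /andP[].
rewrite mulr_sumr; apply: eq_bigr => e eE.
rewrite (eq_bigl (mem e)); last by move=> i; rewrite eE.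
by rewrite sumr_const (sE e eE) mulr_natl.
Qed.

Lemma handshake (R : realType) (N D : nat) (E : {set {set 'I_N}}) :
  simple_graph E -> regular D E -> #|E|%:R = N%:R * D%:R / 2 :> R.
Proof.
move=> sE rE; have := sum_incident_edge R N E (fun=> 1) sE.
rewrite (eq_bigr (fun=> D%:R)); last first.
  by move=> i _; rewrite (sum_incident_const _ _ _ _ _ _ sE rE) mulr1.
by rewrite !sumr_const card_ord -(mulr_natl D%:R N); lra.
Qed.

(** * The strong convexity parameter is of order 1/D *)

Lemma sqnorm2_ge0 (R : realType) (d : nat) (v : 'rV[R]_d) : 0 <= sqnorm2 v.
Proof. by apply: sumr_ge0 => j _; apply: sqr_ge0. Qed.

Lemma sqnorm2_const (R : realType) (d : nat) (t : R) :
  sqnorm2 (const_mx t : 'rV[R]_d) = d%:R * t ^+ 2.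
Proof.
rewrite /sqnorm2 (eq_bigr (fun=> t ^+ 2)); last by move=> j _; rewrite mxE.
by rewrite sumr_const card_ord mulr_natl.
Qed.

Lemma sqnorm2_le_sub (R : realType) (d : nat) (v w : 'rV[R]_d) :
  sqnorm2 w <= 2 * (sqnorm2 v + sqnorm2 (v - w)).
Proof.
rewrite /sqnorm2 -big_split mulr_sumr; apply: ler_sum => j _ /=.
by rewrite !mxE; have := sqr_ge0 (2 * v 0 j - w 0 j); lra.
Qed.

Lemma lambda1_gt0 (R : realType) (mu : R) : 0 < lambda1 mu.
Proof. by rewrite /lambda1 divr_gt0 // ltr_wpDr ?sqrtr_ge0. Qed.

(** Vectors constant on nodes and on edges reduce the problem to a quadratic
    form in two variables, which depends on the graph through D only. *)
Lemma convexity_ineq_const (R : realType) (N d D : nat) (E : {set {set 'I_N}})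
    (beta m mu sigma : R) :
  (0 < N)%N -> (0 < d)%N -> simple_graph E -> regular D E ->
  convexity_ineq d E beta m mu sigma ->
  forall s t : R, sigma * (s ^+ 2 + D%:R / 2 * t ^+ 2) <=
    (mu + lambda1 mu) * s ^+ 2 + 2 * beta * m * D%:R * (s - t) ^+ 2.
Proof.
move=> N0 d0 sE rE cvx s t.
have Nd0 : 0 < N%:R * d%:R :> R by rewrite mulr_gt0 ?ltr0n.
rewrite -(ler_pM2l Nd0).
have := cvx (fun=> const_mx s) (fun=> const_mx t).
have -> : const_mx s - const_mx t = const_mx (s - t) :> 'rV[R]_d.
  by apply/matrixP => i j; rewrite !mxE.
rewrite !sqnorm2_const !sumr_const (eq_bigr _ (fun i _ =>
  sum_incident_const R N D E i _ sE rE)) sumr_const card_ord.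
rewrite -!(mulr_natl (_ * _) N) -(mulr_natl (_ * _) #|E|) (handshake _ _ _ _ sE rE).
by congr (_ <= _); ring.
Qed.

Lemma strong_convexity_le_degree (R : realType) (N d D : nat)
    (E : {set {set 'I_N}}) (beta m mu sigma : R) :
  (0 < N)%N -> (0 < d)%N -> (0 < D)%N -> simple_graph E -> regular D E ->
  0 <= sigma -> convexity_ineq d E beta m mu sigma ->
  sigma * D%:R <= 2 * (mu + lambda1 mu).
Proof.
move=> N0 d0 D0 sE rE s0 cvx.
have := convexity_ineq_const _ _ _ _ _ _ _ _ _ N0 d0 sE rE cvx 1 1.
lra.
Qed.

(** The value t = 1 with s = 0 only gives sigma <= 2b; moving s slightly
    towards t lowers the coupling term to first order and costs only a s^2.
    For D >= 2 and t = 1 the bound is at most a s^2 + 2b (s - 1)^2, which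
    s = 2b/(a+2b) minimises. *)
Lemma strong_convexity_le_gap (R : realType) (N d D : nat)
    (E : {set {set 'I_N}}) (beta m mu sigma : R) :
  0 < beta -> 0 < m -> 0 < mu ->
  (0 < N)%N -> (0 < d)%N -> (2 <= D)%N -> simple_graph E -> regular D E ->
  0 <= sigma -> convexity_ineq d E beta m mu sigma ->
  sigma <= 2 * (2 * beta * m) *
    ((mu + lambda1 mu) / (mu + lambda1 mu + 2 * (2 * beta * m))).
Proof.
move=> beta0 m0 mu0 N0 d0 D2 sE rE s0 cvx.
set a := mu + lambda1 mu; set b := 2 * beta * m.
have a0 : 0 < a by rewrite addr_gt0 ?lambda1_gt0.
have b0 : 0 < b by rewrite !mulr_gt0.
have D2R : 2 <= D%:R :> R by rewrite ler_nat.
set r := 2 * b / (a + 2 * b).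
have ab0 : a + 2 * b != 0 by rewrite gt_eqF // addr_gt0 ?mulr_gt0.
have := convexity_ineq_const _ _ _ _ _ _ _ _ _ N0 d0 sE rE cvx r 1.
rewrite -/a -/b => ineq.
have -> : 2 * b * (a / (a + 2 * b)) = a * r ^+ 2 + 2 * b * (r - 1) ^+ 2.
  by rewrite /r; field.
move: r ineq => r; rewrite expr1n mulr1 => ineq.
have D0 : 0 < D%:R / 2 :> R by lra.
rewrite -(ler_pM2r D0).
have : 0 <= sigma * r ^+ 2 by rewrite mulr_ge0 ?sqr_ge0.
have : 0 <= a * r ^+ 2 * (D%:R / 2 - 1).
  rewrite mulr_ge0 //; last lra.
  by rewrite mulr_ge0 ?sqr_ge0 // ltW.
lra.
Qed.

(** Each edge vector is compared with both of its end points, so the edge mass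
    is at most D times the node mass plus the coupling term. *)
Lemma convexity_ineq_inv_degree (R : realType) (N d D : nat)
    (E : {set {set 'I_N}}) (beta m mu s : R) :
  simple_graph E -> regular D E ->
  0 <= s -> s * D.+1%:R <= mu + lambda1 mu -> s <= 2 * beta * m ->
  convexity_ineq d E beta m mu s.
Proof.
move=> sE rE s0 sa sb x z.
set X := \sum_(i < N) sqnorm2 (x i); set Z := \sum_(e in E) _.
set S := \sum_(i < N) _.
have X0 : 0 <= X by apply: sumr_ge0 => i _; apply: sqnorm2_ge0.
have S0 : 0 <= S.
  by apply: sumr_ge0 => i _; apply: sumr_ge0 => e _; apply: sqnorm2_ge0.
have ZXS : Z <= D%:R * X + S.
  suff : 2 * Z <= 2 * (D%:R * X + S) by lra.
  rewrite -sum_incident_edge // mulr_sumr -big_split mulr_sumr /=.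
  apply: ler_sum => i _.
  rewrite -(sum_incident_const _ _ _ _ i _ sE rE) -big_split mulr_sumr /=.
  by apply: ler_sum => e _; apply: sqnorm2_le_sub.
apply: (@le_trans _ _ (s * (D.+1%:R * X + S))).
  by apply: ler_wpM2l => //; rewrite -natr1; lra.
by rewrite mulrDr mulrA lerD // ler_wpM2r.
Qed.

(** * Logarithms *)

Lemma ln_le_sub1 (R : realType) (y : R) : 0 < y -> ln y <= y - 1.
Proof. by move=> y0; have := expR_ge1Dx (ln y); rewrite lnK ?posrE //; lra. Qed.

Lemma ln_ratio_bounds (R : realType) (A s : R) : 0 <= s -> s < A ->
  s / A <= ln (A / (A - s)) <= s / (A - s).
Proof.
move=> s0 sA; have As0 : 0 < A - s by lra.
have A0 : 0 < A by lra.
apply/andP; split.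
  have := ln_le_sub1 _ _ (divr_gt0 As0 A0).
  rewrite !ln_div ?posrE // mulrBl divff ?gt_eqF //; lra.
have := ln_le_sub1 _ _ (divr_gt0 A0 As0).
have -> // : A / (A - s) - 1 = s / (A - s).
by field; rewrite gt_eqF.
Qed.

(** The numerator is ln P + ln (c0 / (s D)^2), where the second term is bounded.
    As ln P >= ln 4 > 0, this error is absorbed into the upper constant for all
    P; in the lower bound it is absorbed once ln P is at least twice its size,
    whence n0. The denominator is of order s, which k1 and k2 turn into 1/D. *)
Lemma log_ratio_Theta (R : realType) (A theta c0 k1 k2 : R) :
  0 < A -> theta < 1 -> 0 < c0 -> 0 < k1 -> 0 < k2 ->
  exists (c C : R) (n0 : nat), 0 < c /\ 0 < C /\
    forall D P s : R, 0 < D -> 4 <= P -> 0 < s -> s <= A * theta ->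
      k1 <= s * D -> s * D <= k2 ->
      let K := ln (c0 * P / (s * D) ^+ 2) / ln (A / (A - s)) in
      K <= C * (D * ln P) /\ (n0%:R <= P -> c * (D * ln P) <= K).
Proof.
move=> A0 theta1 c00 k10 k20.
set u1 := ln (c0 / k1 ^+ 2); set u2 := ln (c0 / k2 ^+ 2).
have ln4 : 0 < ln 4 :> R by rewrite ln_gt0 // ltr1n.
have C10 : 0 < 1 + `|u1| / ln 4 by rewrite ltr_wpDr ?divr_ge0 ?(ltW ln4).
exists (A * (1 - theta) / (2 * k2)), ((1 + `|u1| / ln 4) * (A / k1)),
  (Num.bound (expR (2 * `|u2|))).
split; first by rewrite divr_gt0 ?mulr_gt0 // subr_gt0.
split; first by rewrite mulr_gt0 ?divr_gt0.
move=> D P s D0 P4 s0 sA k1s sk2 K; rewrite {}/K.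
have P0 : 0 < P by lra.
have lnP4 : ln 4 <= ln P by rewrite ler_ln ?posrE.
have lnP0 : 0 < ln P by lra.
have AsA : A * (1 - theta) <= A - s by lra.
have As0 : 0 < A - s by rewrite (lt_le_trans _ AsA) // mulr_gt0 ?subr_gt0.
have sltA : s < A by lra.
have sD0 : 0 < s * D by rewrite mulr_gt0.
have den0 : 0 < s / A by rewrite divr_gt0.
have /andP[denL denU] := ln_ratio_bounds _ _ _ (ltW s0) sltA.
have denP := lt_le_trans den0 denL.
have -> : ln (c0 * P / (s * D) ^+ 2) = ln P + ln (c0 / (s * D) ^+ 2).
  rewrite -lnM ?posrE ?divr_gt0 ?exprn_gt0 //.
  by congr ln; ring.
have num_mono (x y : R) : 0 < x -> x <= y ->
    ln (c0 / y ^+ 2) <= ln (c0 / x ^+ 2).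
  move=> x0 xy; have y0 := lt_le_trans x0 xy.
  rewrite ler_ln ?posrE ?divr_gt0 ?exprn_gt0 // ler_pM2l //.
  by rewrite lef_pV2 ?posrE ?exprn_gt0 // lerXn2r ?nnegrE // ltW.
have numU := num_mono _ _ k10 k1s.
have numL := num_mono _ _ sD0 sk2.
split.
  rewrite ler_pdivrMr //.
  have num : ln P + ln (c0 / (s * D) ^+ 2) <= (1 + `|u1| / ln 4) * ln P.
    have : `|u1| <= `|u1| / ln 4 * ln P.
      by rewrite mulrAC ler_pdivlMr // ler_wpM2l.
    have := ler_norm u1; rewrite -/u1 in numU; lra.
  apply: (le_trans num).
  have -> : (1 + `|u1| / ln 4) * (A / k1) * (D * ln P) * ln (A / (A - s)) =
      (1 + `|u1| / ln 4) * ln P * (A * D / k1 * ln (A / (A - s))).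
    by ring.
  rewrite ler_peMr ?mulr_ge0 ?(ltW lnP0) ?(ltW C10) //.
  have AD0 : 0 < A * D / k1 by rewrite divr_gt0 ?mulr_gt0.
  apply: le_trans (ler_wpM2l (ltW AD0) denL).
  have -> : A * D / k1 * (s / A) = s * D / k1 by field; rewrite !gt_eqF.
  by rewrite ler_pdivlMr // mul1r.
move=> nP; rewrite ler_pdivlMr //.
have lnPu2 : 2 * `|u2| <= ln P.
  rewrite -ler_expR lnK ?posrE // (le_trans _ nP) // ltW //.
  by apply: archi_boundP; apply: expR_ge0.
have num : ln P / 2 <= ln P + ln (c0 / (s * D) ^+ 2).
  have := ler_norm (- u2); rewrite normrN; rewrite -/u2 in numL; lra.
apply: le_trans num.
have -> : A * (1 - theta) / (2 * k2) * (D * ln P) * ln (A / (A - s)) =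
    ln P / 2 * (A * (1 - theta) * D / k2 * ln (A / (A - s))).
  by field; rewrite gt_eqF.
rewrite ler_piMr ?divr_ge0 ?(ltW lnP0) //.
have At0 : 0 < A * (1 - theta) by rewrite mulr_gt0 ?subr_gt0.
have cst0 : 0 <= A * (1 - theta) * D / k2.
  by rewrite divr_ge0 ?mulr_ge0 ?(ltW At0) ?(ltW D0) ?(ltW k20) //; lra.
apply: (le_trans (ler_wpM2l cst0 denU)).
have -> : A * (1 - theta) * D / k2 * (s / (A - s)) =
    (A * (1 - theta) / (A - s)) * (s * D / k2).
  by field; rewrite !gt_eqF.
rewrite mulr_ile1 ?divr_ge0 ?(ltW At0) ?(ltW As0) ?(ltW sD0) ?(ltW k20) //.
  by rewrite ler_pdivrMr // mul1r.
by rewrite ler_pdivrMr // mul1r.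
Qed.

(** * The number of iterations *)

Theorem theorem3p7 (R : realType) (beta m l mu Mf Ms : R)
    (beta_gt0 : 0 < beta) (m_gt0 : 0 < m) (le_m_l : m <= l) (mu_gt0 : 0 < mu)
    (Mf_gt0 : 0 < Mf) (Ms_gt0 : 0 < Ms) :
  exists (c C : R) (n0 : nat), 0 < c /\ 0 < C /\
    forall (N d D T : nat) (E : {set {set 'I_N}}) (sigma : R),
      (0 < N)%N -> (0 < d)%N -> (0 < T)%N -> (2 <= D)%N ->
      simple_graph E -> regular D E ->
      strong_convexity_param d E beta m mu sigma ->
      let K := K_iter beta l mu Mf Ms N T sigma in
      let g := D%:R * ln (N%:R * D%:R ^+ 2 * T%:R ^+ 4) in
      K <= C * g /\ ((n0 <= N * D ^ 2 * T ^ 4)%N -> c * g <= K).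
Proof.
set a := mu + lambda1 mu; set b := 2 * beta * m.
have lam0 := lambda1_gt0 R mu.
have a0 : 0 < a by rewrite addr_gt0.
have b0 : 0 < b by rewrite !mulr_gt0.
have l0 : 0 < l := lt_le_trans m_gt0 le_m_l.
set A := 4 * beta * l.
have A0 : 0 < A by rewrite !mulr_gt0.
have ab0 : 0 < a + 2 * b by rewrite addr_gt0 ?mulr_gt0.
have theta1 : a / (a + 2 * b) < 1 by rewrite ltr_pdivrMr // mul1r; lra.
set c0 := 128 * beta * l * (Mf + Ms ^+ 2 / 2) * a / lambda1 mu ^+ 2.
have Mfs0 : 0 < Mf + Ms ^+ 2 / 2 by rewrite addr_gt0 // divr_gt0 ?exprn_gt0.
have c00 : 0 < c0 by rewrite divr_gt0 ?exprn_gt0 // !mulr_gt0.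
have min0 : 0 < Num.min a b by rewrite lt_min a0.
have [||c [C [n0 [c_gt0 [C_gt0 bounds]]]]] :=
    log_ratio_Theta R A _ c0 (Num.min a b / 2) (2 * a) A0 theta1 c00.
- by rewrite divr_gt0.
- by rewrite mulr_gt0.
exists c, C, n0; split=> //; split=> //.
move=> N d D T E sigma N0 d0 T0 D2 sE rE [cvx sigma_max] K g.
have D0 : (0 < D)%N by apply: ltnW.
have D0R : 0 < D%:R :> R by rewrite ltr0n.
have D1R : 1 <= D%:R :> R by rewrite ler1n.
have DS0 : 0 < D.+1%:R :> R by rewrite ltr0n.
have sigma_ge : Num.min a b / D.+1%:R <= sigma.
  apply: sigma_max; apply: convexity_ineq_inv_degree sE rE _ _ _.
  - by rewrite divr_ge0 ?(ltW min0) ?(ltW DS0).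
  - by rewrite divfK ?gt_eqF // ge_min lexx.
  - apply: (@le_trans _ _ (Num.min a b)); last by rewrite ge_min lexx orbT.
    by rewrite ler_pdivrMr // ler_peMr ?(ltW min0) // ler1n.
have sigma0 : 0 < sigma by apply: lt_le_trans sigma_ge; rewrite divr_gt0.
have sigmaA : sigma <= A * (a / (a + 2 * b)).
  apply: le_trans (strong_convexity_le_gap _ _ _ _ _ _ _ _ _ beta_gt0 m_gt0
    mu_gt0 N0 d0 D2 sE rE (ltW sigma0) cvx) _.
  rewrite -/a -/b ler_wpM2r ?divr_ge0 ?(ltW a0) ?(ltW ab0) //.
  have : beta * m <= beta * l by rewrite ler_pM2l.
  by rewrite /A /b; lra.
have sDU := strong_convexity_le_degree _ _ _ _ _ _ _ _ _ N0 d0 D0 sE rE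
  (ltW sigma0) cvx.
have sDL : Num.min a b / 2 <= sigma * D%:R.
  (* D + 1 <= 2 D *)
  move: sigma_ge; rewrite ler_pdivrMr // -natr1 => sigma_ge.
  have : sigma <= sigma * D%:R by rewrite ler_peMr // ltW.
  by lra.
have P4 : (4 <= N * D ^ 2 * T ^ 4)%N.
  apply: (@leq_trans (1 * 2 ^ 2 * 1 ^ 4)%N) => //.
  by rewrite !leq_mul ?leq_exp2r.
have PE : N%:R * D%:R ^+ 2 * T%:R ^+ 4 = (N * D ^ 2 * T ^ 4)%:R :> R.
  by rewrite natrM natrX natrM natrX.
have := bounds D%:R (N%:R * D%:R ^+ 2 * T%:R ^+ 4) sigma D0R.
rewrite {1}PE ler_nat => /(_ P4 sigma0 sigmaA sDL sDU).
have -> : c0 * (N%:R * D%:R ^+ 2 * T%:R ^+ 4) / (sigma * D%:R) ^+ 2 =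
    T%:R ^+ 4 * 128 * beta * l * N%:R * (Mf + Ms ^+ 2 / 2)
        * (mu + lambda1 mu) / (sigma * lambda1 mu) ^+ 2.
  by rewrite /c0 /a; field; rewrite !gt_eqF.
by rewrite -(ler_nat R) -PE.
Qed.
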